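(* Let $f:\mathbb{R}^n\to\mathbb{R}$ and $h:\mathbb{R}^n\to\mathbb{R}^m$ be twice differentiable, with $\nabla^2 f$ locally Lipschitz continuous, and let $\bar{x}\in\mathbb{R}^n$ and $\bar{\lambda}\in\mathbb{R}^m$ be given. Define $$Q(d) = f(\bar{x}) + \nabla f(\bar{x})^{\mathsf T} d + \frac12 d^{\mathsf T}\nabla^2_{x,x}\mathcal{L}(\bar{x},\bar{\lambda})\,d,\qquad d\in\mathbb{R}^n .$$ Consider a curve parametrized by $x:\mathbb{R}\to\mathbb{R}^n$ satisfying $$h(x(t)) = h(\bar{x})\ \text{ for all } t\in\mathbb{R},\qquad x(0)=\bar{x}.$$ If $x$ is twice differentiable and $x''$ is locally Lipschitz continuous, then there exist constants $\nu\ge 0$ and $\epsilon>0$ such that $$|f(x(t)) - Q(x'(0)t)| \le \Big(\nu |t| + \frac12\big|x''(0)^{\mathsf T}[\nabla f(\bar{x})+\nabla h(\bar{x})^{\mathsf T}\bar{\lambda}]\big|\Big)t^2\quad\text{for all } t\in(-\epsilon,\epsilon).$$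
   Context: $\mathcal{L}(x,\lambda)=f(x)+\lambda^{\mathsf T}h(x)$ for $x\in\mathbb{R}^n$, $\lambda\in\mathbb{R}^m$ is the Lagrangian of the problem of minimizing $f(x)$ subject to $h(x)=0$, and $\nabla^2_{x,x}\mathcal{L}$ is its Hessian with respect to $x$, so $\nabla^2_{x,x}\mathcal{L}(\bar x,\bar\lambda)=\nabla^2 f(\bar x)+\sum_{i=1}^m\bar\lambda_i\nabla^2 h_i(\bar x)$. For the vector-valued $h$, $\nabla h(\bar{x})\in\mathbb{R}^{m\times n}$ denotes the Jacobian matrix (whose $i$th row is $\nabla h_i(\bar{x})^{\mathsf T}$). *)

(* Defs.v *)
From mathcomp Require Import all_boot all_order all_algebra.
From mathcomp Require Import all_classical all_reals all_analysis.
From mathcomp Require Import lra.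

Set Implicit Arguments.
Unset Strict Implicit.
Unset Printing Implicit Defensive.

Import Order.TTheory GRing.Theory Num.Theory.
Import numFieldNormedType.Exports.

Local Open Scope ring_scope.
Local Open Scope classical_set_scope.

(* Vectors of R^n are the row vectors 'rV[R]_n, the convention of the library's
   Jacobian 'J. Hence 'J h p has entries ('J h p) i j = d h_j / d x_i and is the
   transpose of the textbook m x n Jacobian matrix; accordingly the transpose
   of the textbook Jacobian applied to a column l is the row l *m ('J h p)^T. *)

Definition dotv (R : realType) (n : nat) (u v : 'rV[R]_n) : R :=
  (u *m v^T) 0 0.

Definition gradient (R : realType) (n : nat) (f : 'rV[R]_n -> R)
    (p : 'rV[R]_n) : 'rV[R]_n :=
  \row_(i < n) 'D_(delta_mx 0 i) f p.

Definition hessian (R : realType) (n : nat) (f : 'rV[R]_n -> R)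
    (p : 'rV[R]_n) : 'M[R]_n :=
  'J (gradient f) p.

Definition twice_differentiable (R : realType) (n : nat)
    (f : 'rV[R]_n -> R) : Prop :=
  (forall p, differentiable f p) /\ (forall p, differentiable (gradient f) p).

Definition vector_twice_differentiable (R : realType) (n m : nat)
    (h : 'rV[R]_n -> 'rV[R]_m) : Prop :=
  (forall p, differentiable h p) /\ (forall p, differentiable (jacobian h) p).

Definition curve_twice_differentiable (R : realType) (n : nat)
    (x : R -> 'rV[R]_n) : Prop :=
  (forall t, derivable x t 1) /\ (forall t, derivable x^`() t 1).

Definition lagrangian (R : realType) (n m : nat) (f : 'rV[R]_n -> R)
    (h : 'rV[R]_n -> 'rV[R]_m) (x : 'rV[R]_n) (lambda : 'rV[R]_m) : R :=
  f x + dotv lambda (h x).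

Definition quadratic_model (R : realType) (n m : nat) (f : 'rV[R]_n -> R)
    (h : 'rV[R]_n -> 'rV[R]_m) (xbar : 'rV[R]_n) (lambdabar : 'rV[R]_m)
    (d : 'rV[R]_n) : R :=
  f xbar + dotv (gradient f xbar) d +
  2^-1 * (d *m hessian (fun x => lagrangian f h x lambdabar) xbar *m d^T) 0 0.

Lemma jacobian_gradient (R : realType) (n m : nat) (h : 'rV[R]_n -> 'rV[R]_m) p i j :
  differentiable h p -> ('J h p)^T i j = gradient (fun y => h y 0 i) p 0 j.
Proof.
move=> dh; rewrite !mxE -deriveE// derive_mx ?mxE//.
exact: diff_derivable.
Qed.

Lemma hessianE (R : realType) (n : nat) (f : 'rV[R]_n -> R) p i j :
  differentiable (gradient f) p ->
  hessian f p i j = 'D_(delta_mx 0 i) ('D_(delta_mx 0 j) f) p.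
Proof.
move=> dg; rewrite !mxE -deriveE// derive_mx ?mxE//; last exact: diff_derivable.
by congr derive; apply/funext => y; rewrite mxE.
Qed.

Lemma diff_gradient (R : realType) (n : nat) (f : 'rV[R]_n -> R) p d :
  differentiable f p -> 'd f p d = dotv (gradient f p) d.
Proof.
move=> df; rewrite {1}(row_sum_delta d) linear_sum /dotv mxE /=.
apply: eq_bigr => j _; rewrite linearZ /= !mxE -deriveE//.
by rewrite mulrC.
Qed.

(* [locally lipschitz f] asks for a Lipschitz bound near every pair of points,
   not only near the diagonal; this is no stronger than the usual notion. *)
Lemma locally_lipschitzP (R : realType) (V W : normedModType R) (f : V -> W) :
  [locally lipschitz f] <->
  forall p, exists r : R, 0 < r /\ exists k : R,
    forall u v, ball p r u -> ball p r v -> `|f u - f v| <= k * `|u - v|.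
Proof.
split.
  move=> H p.
  have /= := H (p,p) (conj Logic.I Logic.I).
  rewrite /lipschitz_on => /pinfty_ex_gt0[k k0].
  rewrite /within /= => -[[A B] /= [/nbhs_ballP[a a0 Aa] /nbhs_ballP[b b0 Bb]] AB].
  exists (Num.min a b); split; first by rewrite lt_min a0.
  exists k => u v pu pv; apply: (AB (u, v)) => //; split => /=.
    by apply/Aa/(le_ball _ pu); rewrite ge_min lexx.
  by apply/Bb/(le_ball _ pv); rewrite ge_min lexx orbT.
move=> H [p q] _; have -> : within (setT `*` setT) (nbhs (p, q)) = nbhs (p, q).
  by rewrite setXTT; apply/seteqP; split=> P; rewrite /within /=; apply: filterS => // z; exact.
have [r [r0 [k Hk]]] := H p; have [s [s0 [l Hl]]] := H q.
have [pq|pq] := eqVneq p q.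
  subst q; apply: (@klipschitzW _ _ _ k).
  exists (ball p r, ball p r) => /=; last by move=> [u v] [/= pu pv]; exact: Hk.
  by split; exact: nbhsx_ballx.
pose e := `|p - q| / 4.
have e0 : 0 < e by rewrite divr_gt0// normr_gt0 subr_eq0.
pose M := `|k| * r + `|l| * s + `|f p - f q|.
apply: (@klipschitzW _ _ _ (M / e)).
exists (ball p (Num.min r e), ball q (Num.min s e)) => /=.
  by split; apply: nbhsx_ballx; rewrite lt_min ?r0 ?s0.
move=> [u v] /= [pu qv].
have pr : ball p r u by apply: le_ball pu; rewrite ge_min lexx.
have pe : ball p e u by apply: le_ball pu; rewrite ge_min lexx orbT.
have qs : ball q s v by apply: le_ball qv; rewrite ge_min lexx.
have qe : ball q e v by apply: le_ball qv; rewrite ge_min lexx orbT.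
have := Hk _ _ (ballxx p r0) pr; have := Hl _ _ (ballxx q s0) qs.
move: pr pe qs qe; rewrite -!ball_normE /= => pr pe qs qe h1 h2.
have t1 : `|p - q| <= `|p - u| + `|u - v| + `|q - v|.
  have -> : p - q = (p - u) + (u - v) + (v - q) by rewrite !addrA !subrK.
  by rewrite (distrC q v); apply: le_trans (ler_normD _ _) _; rewrite lerD2r ler_normD.
have t2 : `|f u - f v| <= `|f p - f u| + `|f p - f q| + `|f q - f v|.
  have -> : f u - f v = (f u - f p) + (f p - f q) + (f q - f v) by rewrite !addrA !subrK.
  by rewrite (distrC (f p) (f u)); apply: le_trans (ler_normD _ _) _; rewrite lerD2r ler_normD.
have pq4 : `|p - q| = 4 * e by rewrite /e mulrC divfK// pnatr_eq0.
have uv : e <= `|u - v| by lra.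
have k1 : k * `|p - u| <= `|k| * r.
  by apply: (le_trans (ler_wpM2r _ (ler_norm k))) => //; rewrite ler_wpM2l// ltW.
have l1 : l * `|q - v| <= `|l| * s.
  by apply: (le_trans (ler_wpM2r _ (ler_norm l))) => //; rewrite ler_wpM2l// ltW.
have M0 : 0 <= M by rewrite !addr_ge0// mulr_ge0// ltW.
apply: (@le_trans _ _ M); first by rewrite /self_sub /M /=; lra.
by rewrite mulrAC ler_pdivlMr// ler_wpM2l.
Qed.

(* Main.v *)
(* With L := lagrangian f h _ lambdabar, the level-set condition makes L o x
   differ from f o x by a constant, so both have the same second derivative
   x'^T (hessian L) x' + gradient L . x'' at 0. The quadratic model is thus the
   second-order Taylor polynomial of f o x minus 2^-1 (gradient L . x'') t^2.
   The Taylor remainder is controlled by |t|^3 because (f o x)'', written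
   without h as x'^T (hessian f) x' + gradient f . x'', is Lipschitz at 0. *)

Require Import Defs.
From HB Require Import structures.
From mathcomp Require Import all_boot all_order all_algebra.
From mathcomp Require Import all_classical all_reals all_analysis.
From mathcomp Require Import ring.

Import Order.TTheory GRing.Theory Num.Theory.
Import numFieldNormedType.Exports.

Local Open Scope ring_scope.
Local Open Scope classical_set_scope.

(** * Calculus of Lipschitz bounds at a single point *)

(* A Lipschitz bound against the single point [a]: unlike local Lipschitz
   continuity it follows from differentiability at [a] alone. *)
Definition calm_at {R : realType} {V W : normedModType R} (g : V -> W) (a : V) :=
  exists2 k : R, 0 <= k & \forall y \near a, `|g y - g a| <= k * `|y - a|.

Lemma calm_at_cvg {R : realType} {V W : normedModType R} (g : V -> W) (a : V) :
  calm_at g a -> {for a, continuous g}.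
Proof.
move=> [k k0 gk]; apply/cvgrPdist_lt => e e0.
(* Dividing by [k + 1] covers the case [k = 0] and makes the final inequality strict. *)
have d0 : 0 < e / (k + 1) by rewrite divr_gt0// ltr_wpDl.
have ya : \forall y \near a, `|y - a| < e / (k + 1).
  exact: (@cvgr_distC_lt _ _ _ _ _ id a).
near=> y.
rewrite distrC; apply: (@le_lt_trans _ _ (k * `|y - a|)).
  by near: y; exact: gk.
apply: (@le_lt_trans _ _ (k * (e / (k + 1)))).
  apply: ler_wpM2l => //; apply/ltW; near: y.
by rewrite mulrA ltr_pdivrMr ?ltr_wpDl// mulrDr mulr1 mulrC ltrDl.
Unshelve. all: by end_near. Qed.

(** The bound on [u] makes it continuous at [a], so [u y] ends up where the bound on [g] holds; the
    constants then multiply. *)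
Lemma calm_at_comp {R : realType} {U V W : normedModType R} (u : U -> V)
    (g : V -> W) (a : U) :
  calm_at u a -> calm_at g (u a) -> calm_at (g \o u) a.
Proof.
move=> cu [l l0 gl]; have [k k0 uk] := cu.
exists (l * k); first exact: mulr_ge0.
have gu := calm_at_cvg _ _ cu _ gl.
near=> y; rewrite /= -mulrA.
apply: (@le_trans _ _ (l * `|u y - u a|)); first by near: y; exact: gu.
by apply: ler_wpM2l => //; near: y; exact: uk.
Unshelve. all: by end_near. Qed.

Lemma calm_at_lipschitz {R : realType} {V W : normedModType R} (g : V -> W)
    (a : V) : [locally lipschitz g] -> calm_at g a.
Proof.
move=> /locally_lipschitzP/(_ a)[r [r0 [k gk]]].
(* The constant extracted from the hypothesis has no sign condition, hence the absolute value. *)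
exists `|k| => //; near=> y.
apply: (@le_trans _ _ (k * `|y - a|)); last by rewrite ler_wpM2r// ler_norm.
by apply: gk (ballxx _ r0); near: y; exact: nbhsx_ballx.
Unshelve. all: by end_near. Qed.

(** The differential is a continuous linear map, hence Lipschitz with some constant [k], and the
    little-o remainder is eventually at most [1] times the increment: together [k + 1]. *)
Lemma calm_at_diff {R : realType} {V W : normedModType R} (g : V -> W) (a : V) :
  differentiable g a -> calm_at g a.
Proof.
move=> dg.
have [k k0 dk] := linear_lipschitz (diff_continuous dg).
exists (k + 1); first by rewrite addr_ge0// ltW.
have /eqaddoP/(_ 1 ltr01) ga := diff_locally dg.
rewrite (near_shift 0 a); near=> y.
rewrite /= /shift/= subr0 addrK -(subrK ('d g a y) (g (y + a) - g a)).
rewrite mulrDl mul1r addrC; apply: (le_trans (ler_normD _ _)).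
apply: lerD; first exact: dk.
near: y; apply: filterS ga => y /=.
by rewrite mul1r /shift/= !fctE /= opprD addrA.
Unshelve. all: by end_near. Qed.

Lemma calm_at_coord {R : realType} {V : normedModType R} (m n : nat)
    (g : V -> 'M[R]_(m, n)) (a : V) i j :
  calm_at g a -> calm_at (fun y => g y i j) a.
Proof.
move=> cg; apply: (@calm_at_comp _ _ _ _ g (fun M : 'M[R]_(m, n) => M i j)) => //.
exact/calm_at_diff/differentiable_coord.
Qed.

Lemma calm_atD {R : realType} {V W : normedModType R} (g1 g2 : V -> W) (a : V) :
  calm_at g1 a -> calm_at g2 a -> calm_at (fun y => g1 y + g2 y) a.
Proof.
move=> [k k0 gk] [l l0 gl]; exists (k + l); first exact: addr_ge0.
near=> y; rewrite opprD addrACA mulrDl.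
by apply: (le_trans (ler_normD _ _)); apply: lerD; near: y.
Unshelve. all: by end_near. Qed.

Lemma calm_at_sum {R : realType} {V W : normedModType R} (I : Type) (r : seq I)
    (g : I -> V -> W) (a : V) :
  (forall i, calm_at (g i) a) -> calm_at (fun y => \sum_(i <- r) g i y) a.
Proof.
move=> cg; elim: r => [|i r ih].
  exists 0 => //; near=> y.
  by rewrite !big_nil subrr normr0 mul0r.
rewrite [X in calm_at X _](_ : _ = fun y => g i y + \sum_(i <- r) g i y).
  exact: calm_atD.
by apply/funext => y; rewrite big_cons.
Unshelve. all: by end_near. Qed.

Lemma calm_atM {R : realType} {V : normedModType R} (g1 g2 : V -> R) (a : V) :
  calm_at g1 a -> calm_at g2 a -> calm_at (fun y => g1 y * g2 y) a.
Proof.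
move=> [k k0 gk] c2; have [l l0 gl] := c2.
(* Split as in the product rule; [g2 y] is bounded near [a] by [|g2 a| + 1] through continuity. *)
exists (k * (`|g2 a| + 1) + `|g1 a| * l).
  by rewrite addr_ge0 ?mulr_ge0 ?addr_ge0.
have c2lt : \forall y \near a, `|g2 y - g2 a| < 1.
  by have /cvgr_distC_lt := calm_at_cvg _ _ c2; exact.
near=> y.
have -> : g1 y * g2 y - g1 a * g2 a =
  (g1 y - g1 a) * g2 y + g1 a * (g2 y - g2 a) by ring.
apply: (le_trans (ler_normD _ _)); rewrite [leRHS]mulrDl; apply: lerD.
  rewrite normrM -mulrA [(_ + 1) * _]mulrC mulrA; apply: ler_pM => //.
    by near: y.
  rewrite -[g2 y](subrK (g2 a)) addrC (le_trans (ler_normD _ _))// lerD2l.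
  by apply/ltW; near: y.
by rewrite normrM -mulrA ler_wpM2l//; near: y.
Unshelve. all: by end_near. Qed.

(** Working entrywise reduces to sums of scalar products and lets the lemma be iterated on nested
    products. *)
Lemma calm_at_mulmx {R : realType} {V : normedModType R} (m n p : nat)
    (A : V -> 'M[R]_(m, n)) (B : V -> 'M[R]_(n, p)) (a : V) :
  (forall i j, calm_at (fun y => A y i j) a) ->
  (forall i j, calm_at (fun y => B y i j) a) ->
  forall i j, calm_at (fun y => (A y *m B y) i j) a.
Proof.
move=> cA cB i j.
rewrite [X in calm_at X _](_ : _ = fun y => \sum_k A y i k * B y k j).
  by apply: calm_at_sum => k; exact: calm_atM.
by apply/funext => y; rewrite mxE.
Qed.

(** * Second-order Taylor estimate with cubic remainder *)

(** Covers both signs of [t]; of the location of [c] only its size is kept. *)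
Lemma mean_value0 {R : realType} (g dg : R -> R) (t : R) :
  (forall s : R, is_derive s 1 g (dg s)) ->
  exists2 c, `|c| <= `|t| & g t - g 0 = dg c * t.
Proof.
move=> gE.
have cg a b : {within `[a, b], continuous g}.
  by apply: derivable_within_continuous => s _; exact: (@ex_derive _ _ _ _ _ _ _ (gE s)).
have [t0|t0] := leP 0 t.
  have [c] := MVT_segment t0 (fun s _ => gE s) (cg _ _).
  rewrite in_itv/= subr0 => /andP[c0 ct] ->; exists c => //.
  by rewrite !ger0_norm.
have [c] := MVT_segment (ltW t0) (fun s _ => gE s) (cg _ _).
rewrite in_itv/= => /andP[tc c0] e; exists c.
  by rewrite !ler0_norm ?lerN2// ltW.
by rewrite -opprB e; ring.
Qed.

(** Two mean value steps write the error as [(ddg b - ddg 0) * c * t] with [|b| <= |c| <= |t|]. The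
    bound on [ddg] at [0] supplies the third factor [|t|], with the same constant. *)
Lemma taylor2_calm {R : realType} (g dg ddg : R -> R) :
  (forall s : R, is_derive s 1 g (dg s)) ->
  (forall s : R, is_derive s 1 dg (ddg s)) ->
  calm_at ddg 0 ->
  exists2 k, 0 <= k & \forall t \near (0 : R),
    `|g t - (g 0 + dg 0 * t + 2^-1 * ddg 0 * t ^+ 2)| <= k * `|t| ^+ 3.
Proof.
move=> gE dgE [k k0 /nbhs_ballP[e /= e0 ek]]; exists k => //.
apply/nbhs_ballP; exists e => //= t; rewrite /ball/= sub0r normrN => te.
(* The constant term [g 0] stays in [r], so the Taylor error is [r t - r 0], while [dr 0 = 0]. *)
pose r u := g u - (dg 0 * u + 2^-1 * ddg 0 * u ^+ 2).
pose dr u := dg u - dg 0 - ddg 0 * u.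
have rE (s : R) : is_derive s 1 r (dr s).
  rewrite /r; apply: is_derive_eq; rewrite /dr /GRing.scale/=.
  by field.
have drE (s : R) : is_derive s 1 dr (ddg s - ddg 0).
  rewrite /dr; apply: is_derive_eq; rewrite /GRing.scale/=; ring.
have [c ct] := mean_value0 r dr t rE.
have [b bc] := mean_value0 dr (fun s => ddg s - ddg 0) c drE.
rewrite {2}/dr mulr0 subr0 subrr subr0 => -> rt.
have -> : g t - (g 0 + dg 0 * t + 2^-1 * ddg 0 * t ^+ 2) = r t - r 0.
  by rewrite /r; ring.
rewrite rt !normrM exprSr expr2 !mulrA.
have bt := le_trans bc ct.
have : `|ddg b - ddg 0| <= k * `|b - 0|.
  by apply: ek; rewrite /ball/= sub0r normrN (le_lt_trans bt).
rewrite subr0 => db; apply: ler_wpM2r => //; apply: ler_pM => //.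
by apply: (le_trans db); rewrite ler_wpM2l.
Qed.

(** * Product and chain rules for vector-valued functions *)

Lemma is_derive_coord {R : realType} {V : normedModType R} (m n : nat)
    (M : V -> 'M[R]_(m, n)) (dM : 'M[R]_(m, n)) (t v : V) i j :
  is_derive t v M dM -> is_derive t v (fun s => M s i j) (dM i j).
Proof.
move=> [exM <-]; split; last by rewrite derive_mx// mxE.
by move/derivable_mxP : exM; exact.
Qed.

Lemma is_derive_dotv {R : realType} {V : normedModType R} (n : nat)
    (u w : V -> 'rV[R]_n) (du dw : 'rV[R]_n) (t v : V) :
  is_derive t v u du -> is_derive t v w dw ->
  is_derive t v (fun s => dotv (u s) (w s)) (dotv du (w t) + dotv (u t) dw).
Proof.
move=> uE wE.
have cu i := is_derive_coord _ _ u du t v 0 i uE.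
have cw i := is_derive_coord _ _ w dw t v 0 i wE.
rewrite [X in is_derive _ _ X](_ : _ = \sum_i (fun s => u s 0 i * w s 0 i)); last first.
  by apply/funext => s; rewrite fct_sumE /dotv mxE; apply: eq_bigr => i _; rewrite mxE.
apply: is_derive_eq; rewrite /dotv !mxE -big_split/=; apply: eq_bigr => i _.
by rewrite !mxE /GRing.scale/=; ring.
Qed.

Lemma is_derive_comp_curve {R : realType} {V W : normedModType R}
    (F : V -> W) (x : R -> V) (dx : V) (t : R) :
  differentiable F (x t) -> is_derive t 1 x dx ->
  is_derive t 1 (F \o x) ('d F (x t) dx).
Proof.
move=> dF [/derivable1_diffP dx1 <-].
have dFx : differentiable (F \o x) t by exact: differentiable_comp.
split; first exact/diff_derivable.
by rewrite !deriveE// diff_comp.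
Qed.

(** * Differentiability of linear maps and of the Lagrangian *)

(** In finite dimension a linear map is a finite sum of coordinate functions times its values on the
    basis matrices. *)
Lemma linear_mx_differentiable {R : realType} (m n : nat) (W : normedModType R)
    (g : {linear 'M[R]_(m, n) -> W}) M : differentiable g M.
Proof.
rewrite [X in differentiable X _](_ : _ =
  \sum_i \sum_j (fun N : 'M[R]_(m, n) => N i j *: g (delta_mx i j))).
  apply: differentiable_sum => i; apply: differentiable_sum => j.
  exact/differentiableZl/differentiable_coord.
apply/funext => N; rewrite {1}(matrix_sum_delta N) linear_sum fct_sumE.
apply: eq_bigr => i _; rewrite linear_sum fct_sumE.
by apply: eq_bigr => j _; rewrite linearZ.
Qed.

Lemma linear_mx_is_diff {R : realType} (m n : nat) (W : normedModType R)
    (g : {linear 'M[R]_(m, n) -> W}) M : is_diff M g g.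
Proof.
apply: DiffDef; first exact: linear_mx_differentiable.
apply: diff_lin => N; exact/differentiable_continuous/linear_mx_differentiable.
Qed.

Lemma dotv_is_linear {R : realType} (n : nat) (l : 'rV[R]_n) : linear (dotv l).
Proof.
by move=> a u v; rewrite /dotv linearP /= mulmxDr -scalemxAr !mxE.
Qed.

HB.instance Definition _ (R : realType) (n : nat) (l : 'rV[R]_n) :=
  GRing.isLinear.Build R 'rV[R]_n R _ (dotv l) (dotv_is_linear n l).

Lemma is_diff_lagrangian {R : realType} (n m : nat) (f : 'rV[R]_n -> R)
    (h : 'rV[R]_n -> 'rV[R]_m) (l : 'rV[R]_m) p :
  differentiable f p -> differentiable h p ->
  is_diff p (fun y => lagrangian f h y l)
    (fun v => 'd f p v + dotv l ('d h p v)).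
Proof.
move=> df dh.
have dl := linear_mx_is_diff _ _ _ (dotv l) (h p).
apply: (is_diffD (differentiableP df)).
exact: (is_diff_comp (differentiableP dh) dl).
Qed.

(** Identifies the bracket in the final bound as the gradient of the Lagrangian. *)
Lemma gradient_lagrangian {R : realType} (n m : nat) (f : 'rV[R]_n -> R)
    (h : 'rV[R]_n -> 'rV[R]_m) (l : 'rV[R]_m) p :
  differentiable f p -> differentiable h p ->
  gradient (fun y => lagrangian f h y l) p = gradient f p + l *m ('J h p)^T.
Proof.
move=> df dh; have dL := is_diff_lagrangian _ _ f h l p df dh.
apply/rowP => i; rewrite !mxE !deriveE//.
rewrite diff_val; congr (_ + _); rewrite /dotv mxE; apply: eq_bigr => j _.
by rewrite !mxE.
Qed.

Lemma differentiable_gradient_lagrangian {R : realType} (n m : nat)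
    (f : 'rV[R]_n -> R) (h : 'rV[R]_n -> 'rV[R]_m) (l : 'rV[R]_m) p :
  twice_differentiable f -> vector_twice_differentiable h ->
  differentiable (gradient (fun y => lagrangian f h y l)) p.
Proof.
move=> [df ddf] [dh ddh].
(* The gradient formula shows a sum of [gradient f] and a linear image of [jacobian h], both
   differentiable. *)
rewrite [X in differentiable X _](_ : _ =
  gradient f + ((fun M : 'M[R]_(n, m) => l *m M^T) \o jacobian h)); last first.
  by apply/funext => y; rewrite gradient_lagrangian.
apply: differentiableD => //; apply: differentiable_comp => //.
exact: (linear_mx_differentiable _ _ _ (mulmx l \o trmx)).
Qed.

(** * First and second derivatives of a function along a curve *)

Lemma is_derive_curve {R : realType} (n : nat) (g : 'rV[R]_n -> R)
    (x dx : R -> 'rV[R]_n) t :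
  differentiable g (x t) -> is_derive t 1 x (dx t) ->
  is_derive t 1 (g \o x) (dotv (gradient g (x t)) (dx t)).
Proof.
by move=> dg xE; rewrite -diff_gradient//; exact: is_derive_comp_curve.
Qed.

(** Product rule, where [gradient g] along the curve has derivative [dx t *m hessian g (x t)], rows
    being multiplied on the right. It serves both [f] and the Lagrangian. *)
Lemma is_derive2_curve {R : realType} (n : nat) (g : 'rV[R]_n -> R)
    (x dx ddx : R -> 'rV[R]_n) t :
  differentiable (gradient g) (x t) ->
  is_derive t 1 x (dx t) -> is_derive t 1 dx (ddx t) ->
  is_derive t 1 (fun s => dotv (gradient g (x s)) (dx s))
    (dotv (dx t *m hessian g (x t)) (dx t) + dotv (gradient g (x t)) (ddx t)).
Proof.
move=> dg xE dxE; apply: is_derive_dotv => //.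
rewrite /hessian /jacobian mul_rV_lin1.
exact: (is_derive_comp_curve (gradient g) x (dx t) t dg xE).
Qed.

Lemma is_derive_derive1 {R : realType} {V : normedModType R} (x : R -> V) t :
  derivable x t 1 -> is_derive t 1 x ((x^`())%classic t).
Proof. by move=> dx; rewrite derive1E; exact: derivableP. Qed.

Theorem theorem4p1p1 (R : realType) (n m : nat)
    (f : 'rV[R]_n -> R) (h : 'rV[R]_n -> 'rV[R]_m)
    (f_diff2 : twice_differentiable f)
    (h_diff2 : vector_twice_differentiable h)
    (hess_f_lip : [locally lipschitz (hessian f)])
    (xbar : 'rV[R]_n) (lambdabar : 'rV[R]_m)
    (x : R -> 'rV[R]_n)
    (x_level : forall t : R, h (x t) = h xbar)
    (x_0 : x 0 = xbar)
    (x_diff2 : curve_twice_differentiable x)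
    (x''_lip : [locally lipschitz (x^`(2))]) :
  exists nu eps : R,
    [/\ 0 <= nu, 0 < eps &
      forall t : R, - eps < t < eps ->
        `|f (x t) - quadratic_model f h xbar lambdabar (t *: (x^`() 0)%classic)|
          <= (nu * `|t| +
              2^-1 * `|dotv (x^`(2) 0)%classic
                         (gradient f xbar + lambdabar *m ('J h xbar)^T)|)
             * t ^+ 2].
Proof.
have [df ddf] := f_diff2; have [dh _] := h_diff2; have [dx ddx] := x_diff2.
set x1 := (x^`())%classic; set x2 := (x^`(2))%classic.
have xE (t : R) : is_derive t 1 x (x1 t).
  exact: (is_derive_derive1 x t (dx t)).
have x1E (t : R) : is_derive t 1 x1 (x2 t).
  rewrite /x2 derive1nS derive1n1; exact: (is_derive_derive1 x1 t (ddx t)).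
pose L y := lagrangian f h y lambdabar.
have dL p : differentiable L p.
  by have [] := is_diff_lagrangian n m f h lambdabar p (df p) (dh p).
have LxE t : L (x t) = f (x t) + dotv lambdabar (h xbar).
  by rewrite /L /lagrangian x_level.
pose phi1 t := dotv (gradient f (x t)) (x1 t).
pose phi2 t := dotv (x1 t *m hessian f (x t)) (x1 t) + dotv (gradient f (x t)) (x2 t).
have phiE (t : R) : is_derive t 1 (f \o x) (phi1 t) by exact: is_derive_curve.
have phi1E (t : R) : is_derive t 1 phi1 (phi2 t) by exact: is_derive2_curve.
have calmx : calm_at x 0 by apply/calm_at_diff/derivable1_diffP.
have calmx1 : calm_at x1 0 by apply/calm_at_diff/derivable1_diffP.
(* The Lipschitz hypotheses handle [hessian f] and [x2]; differentiability handles [x], [x1] and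
   [gradient f]. *)
have calm2 : calm_at phi2 0.
  apply: calm_atD; rewrite /dotv; apply: calm_at_mulmx => i j.
  - apply: calm_at_mulmx => {}i {}j; first exact: calm_at_coord.
    apply: calm_at_coord; apply: (@calm_at_comp _ _ _ _ x (hessian f)) => //.
    exact: calm_at_lipschitz.
  - under eq_fun do rewrite mxE; exact: calm_at_coord.
  - apply: calm_at_coord; apply: (@calm_at_comp _ _ _ _ x (gradient f)) => //.
    exact: calm_at_diff.
  - under eq_fun do rewrite mxE; apply: calm_at_coord.
    exact: calm_at_lipschitz.
have derive_unique (g : R -> R) (t a b : R) :
    is_derive t 1 g a -> is_derive t 1 g b -> a = b.
  by move=> [_ <-] [_ <-].
(* This holds at every [t], not only at [0], so that it can be differentiated once more. *)
have phi1L t : phi1 t = dotv (gradient L (x t)) (x1 t).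
  apply: (derive_unique (L \o x) t); last first.
    exact: (is_derive_curve n L x x1 t (dL _)).
  have -> : L \o x = (f \o x) + cst (dotv lambdabar (h xbar)).
    by apply/funext => s; exact: LxE.
  rewrite -[phi1 t]addr0; exact: is_deriveD.
(* Both sides are the derivative of [phi1] at [0], computed through [f] and through [L]. *)
have phi2L : phi2 0 = dotv (x1 0 *m hessian L xbar) (x1 0)
    + dotv (gradient L xbar) (x2 0).
  apply: (derive_unique phi1 0) => //.
  have -> : phi1 = fun t => dotv (gradient L (x t)) (x1 t) by apply/funext.
  rewrite -x_0; apply: is_derive2_curve => //.
  exact: differentiable_gradient_lagrangian.
have [k k0 /nbhs_ballP[e /= e0 fk]] := taylor2_calm (f \o x) phi1 phi2 phiE phi1E calm2.
(* [nu] is the cubic remainder constant and [eps] the radius on which that estimate holds. *)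
exists k, e; split => // t te.
have {}te : ball 0 e t by rewrite /ball/= sub0r normrN ltr_norml.
set G := gradient f xbar + _.
have GE : gradient L xbar = G by exact: gradient_lagrangian.
have dotvC (u v : 'rV[R]_n) : dotv u v = dotv v u.
  by rewrite /dotv !mxE; apply: eq_bigr => i _; rewrite !mxE mulrC.
(* By [phi1 0] and [phi2L], the model at [t *: x1 0] lacks only the acceleration term of the Taylor
   polynomial. *)
have -> : quadratic_model f h xbar lambdabar (t *: x1 0) =
    (f (x 0) + phi1 0 * t + 2^-1 * phi2 0 * t ^+ 2)
    - 2^-1 * dotv (x2 0) G * t ^+ 2.
  have dotvZ a (u v : 'rV[R]_n) : dotv u (a *: v) = a * dotv u v.
    exact: linearZ.
  have formZ a (u : 'rV[R]_n) (H : 'M[R]_n) :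
      ((a *: u) *m H *m (a *: u)^T) 0 0 = a ^+ 2 * dotv (u *m H) u.
    by rewrite linearZ /= -scalemxAr -!scalemxAl scalerA mxE.
  by rewrite phi2L GE (dotvC G) /quadratic_model /phi1 x_0 dotvZ formZ; ring.
(* The triangle inequality separates the Taylor error from the acceleration term. *)
rewrite opprB addrCA addrC; apply: (le_trans (ler_normD _ _)).
rewrite mulrDl; apply: lerD.
  have -> : k * `|t| * t ^+ 2 = k * `|t| ^+ 3.
    by rewrite -(real_normK (num_real t)); ring.
  exact: fk.
by rewrite normrM (ger0_norm (sqr_ge0 t)) normrM ger0_norm ?invr_ge0.
Qed.
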